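(* Let $q$ be a prime power, let $1\le t\le k\le v$ be integers and let $\lambda\ge 0$ be a rational number. Suppose that the derived and the residual parameter set of the parameter set $t$-$(v,k,\lambda)_q$ are realizable, i.e. that there exist a $(t-1)$-$(v-1,k-1,\lambda)_q$ design and a $(t-1)$-$\left(v-1,k,\lambda\cdot\frac{q^{v-k}-1}{q^{k-t+1}-1}\right)_q$ design. Then the reduced parameter set is realizable, too, i.e. there exists a $(t-1)$-$\left(v,k,\lambda\cdot\frac{q^{v-t+1}-1}{q^{k-t+1}-1}\right)_q$ design. (It is not assumed that a $t$-$(v,k,\lambda)_q$ design exists.)
   Context: For a finite-dimensional vector space $V$ over the finite field $\mathrm{GF}(q)$, a $k$-subspace is a linear subspace of dimension $k$. For a $v$-dimensional vector space $V$ over $\mathrm{GF}(q)$, a pair $(V,\mathcal{B})$ with $\mathcal{B}$ a set of $k$-subspaces of $V$ (called blocks) is a $t$-$(v,k,\lambda)_q$ (subspace) design if every $t$-subspace of $V$ is contained in exactly $\lambda$ elements of $\mathcal{B}$. A parameter set $t$-$(v,k,\lambda)_q$ is realizable if a $t$-$(v,k,\lambda)_q$ design exists. For a parameter set $t$-$(v,k,\lambda)_q$: the reduced parameter set is $(t-1)$-$(v,k,\lambda_{t-1})_q$ with $\lambda_{t-1}=\lambda\cdot\frac{q^{v-t+1}-1}{q^{k-t+1}-1}$; the derived parameter set is $(t-1)$-$(v-1,k-1,\lambda)_q$; the residual parameter set is $(t-1)$-$\left(v-1,k,\lambda\cdot\frac{q^{v-k}-1}{q^{k-t+1}-1}\right)_q$.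 *)

(* Defs.v *)
From HB Require Import structures.
From mathcomp Require Import all_boot all_order all_algebra.
From mathcomp Require Import finmap.

Set Implicit Arguments.
Unset Strict Implicit.
Unset Printing Implicit Defensive.

Import Order.TTheory GRing.Theory Num.Theory.
Local Open Scope ring_scope.
Local Open Scope fset_scope.

(* GF(q) is an arbitrary finite field F with q elements.  As F is finite, V has
   only finitely many subspaces, so a finite set B is no restriction. *)
Definition is_subspace_design (F : finFieldType) (V : vectType F)
    (t v k : nat) (lam : rat) (B : {fset {vspace V}}) : Prop :=
  [/\ \dim {: V} = v,
      forall K : {vspace V}, K \in B -> \dim K = k
    & forall T : {vspace V}, \dim T = t ->
        #|` [fset K in B | (T <= K)%VS]|%:R = lam].

(* The data t, v, k, lambda of t-(v,k,lambda)_q; q is carried by the field.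
   The index lambda is rational, since the derived quantities below need not be
   integers. *)
Record params := Params
  { strength : nat; dimV : nat; dimK : nat; lambda : rat }.

Definition realizable (F : finFieldType) (P : params) : Prop :=
  exists (V : vectType F) (B : {fset {vspace V}}),
    is_subspace_design (strength P) (dimV P) (dimK P) (lambda P) B.

(* The natural-number subtractions below are exact when
   1 <= strength P <= dimK P <= dimV P. *)
Definition reduced_params (q : nat) (P : params) : params :=
  let: Params t v k lam := P in
  Params (t - 1) v k
    (lam * ((q%:R ^+ (v - t + 1) - 1) / (q%:R ^+ (k - t + 1) - 1))).

Definition derived_params (P : params) : params :=
  let: Params t v k lam := P in Params (t - 1) (v - 1) (k - 1) lam.

Definition residual_params (q : nat) (P : params) : params :=
  let: Params t v k lam := P in
  Params (t - 1) (v - 1) k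
    (lam * ((q%:R ^+ (v - k) - 1) / (q%:R ^+ (k - t + 1) - 1))).

(* Main.v *)
Require Import Defs.
From HB Require Import structures.
From mathcomp Require Import all_boot all_order all_algebra.
From mathcomp Require Import finmap.
From mathcomp Require Import finfield.
From mathcomp Require Import zify ring.

(* Fix a point P of a v-dimensional space V and identify V / P with the ambient
   spaces of both given designs.  The blocks are the K >= P with K / P a block
   of the derived design, and the K with K /\ P = 0 whose image in V / P is a
   block of the residual design.  A (t-1)-space T off P lies in lambda blocks of
   the first kind; each residual block above its image has q ^ (k-t+1) lifts
   through T, and the two counts add up to
     lambda * (1 + q^(k-t+1) * (q^(v-k) - 1) / (q^(k-t+1) - 1))
       = lambda * (q^(v-t+1) - 1) / (q^(k-t+1) - 1).
   If T contains P, only blocks of the first kind occur, and they are counted by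
   the derived design regarded as a (t-2)-design. *)

Set Implicit Arguments.
Unset Strict Implicit.
Unset Printing Implicit Defensive.

Import Order.TTheory GRing.Theory Num.Theory.
Local Open Scope ring_scope.

Import passmx.

(** Subspaces inherit finiteness from their matrix encoding, so that cardinals and sums can range
    over all of them. *)
HB.instance Definition _ (F : finFieldType) (V : vectType F) :=
  isCountable.Build {vspace V}
    (pcan_pickleK (can_pcan VectorInternalTheory.vs2mxK)).
HB.instance Definition _ (F : finFieldType) (V : vectType F) :=
  isFinite.Build {vspace V}
    (pcan_enumP (can_pcan VectorInternalTheory.vs2mxK)).

Lemma card_fset_sep (T : finType) (B : {fset T}) (P : pred T) :
  #|` [fset x in B | P x]%fset | = #|[pred x | (x \in B) && P x]|.
Proof.
rewrite -card_finset; congr #|` _|; apply/fsetP => x.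
by rewrite !inE.
Qed.

(** * Counting subspaces over a finite field *)

Section Counting.
Variables (F : finFieldType) (V : vectType F).
Implicit Types (K L P S T U : {vspace V}).
Let q := #|F|.

Lemma card_mem_vspace U : #|[pred x : finvect_type V | x \in U]| = (q ^ \dim U)%N.
Proof.
rewrite /q; case: V U => T cT U.
rewrite -(@card_vspace F (finvect_type (Vector.Pack cT)) cT U).
by apply: eq_card => x; rewrite !inE.
Qed.

Lemma card_vspaceD U L : (U <= L)%VS ->
  #|[pred x : finvect_type V | (x \in L) && (x \notin U)]|
  = (q ^ \dim L - q ^ \dim U)%N.
Proof.
move=> UL; rewrite -!card_mem_vspace.
rewrite -[in X in (X - _)%N](cardID [pred x : finvect_type V | x \in U]).
rewrite [X in (X + _ - _)%N](_ : _ = #|[pred x : finvect_type V | x \in U]|).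
  by rewrite addKn; apply: eq_card => x; rewrite !inE andbC.
apply: eq_card => x; rewrite !inE andbC; apply: andb_idr; exact: (subvP UL).
Qed.

(* Double counting of the pairs [(x, K)] with [S <= K], [x \in K], [x \notin U]. *)
Lemma card_superspaces (C : pred {vspace V}) L S U (k m : nat) :
  (S <= U)%VS -> (U <= L)%VS ->
  (forall K, C K -> (S <= K)%VS ->
     [/\ (K <= L)%VS, \dim K = k & (K :&: U)%VS = S]) ->
  (forall x, x \in L -> x \notin U ->
     #|[pred K | C K && (S + <[x]> <= K)%VS]| = m) ->
  (#|[pred K | C K && (S <= K)%VS]| * (q ^ k - q ^ \dim S)
   = m * (q ^ \dim L - q ^ \dim U))%N.
Proof.
move=> SU UL HC Hm.
rewrite -(card_vspaceD UL) mulnC [RHS]mulnC.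
pose N (x : finvect_type V) K := [&& x \in L, x \notin U, C K, (S <= K)%VS & x \in K].
have -> : (#|[pred x : finvect_type V | (x \in L) && (x \notin U)]| * m =
   \sum_(x : finvect_type V) #|[pred K | N x K]|)%N.
  rewrite -sum_nat_const big_mkcond /=; apply: eq_bigr => x _.
  rewrite inE; case: ifP => [/andP[xL xU]|xF].
    rewrite -(Hm x xL xU); apply: eq_card => K.
    by rewrite !inE /N xL xU subv_add.
  by rewrite eq_card0 // => K; rewrite !inE /N andbA xF.
have -> : (\sum_(x : finvect_type V) #|[pred K | N x K]| =
           \sum_K #|[pred x | N x K]|)%N.
  under eq_bigr do rewrite -sum1_card big_mkcond /=.
  rewrite exchange_big; apply: eq_bigr => K _.
  by rewrite -sum1_card big_mkcond.
rewrite mulnC -sum_nat_const big_mkcond /=; apply: eq_bigr => K _.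
rewrite inE; case: ifP => [/andP[CK SK]|xF]; last first.
  rewrite eq_card0 // => x; rewrite !inE /N.
  by rewrite (andbA (C K)) xF !andbF.
(* For fixed [K] the vectors counted are those of [K] outside [U], that is, outside
   [K :&: U = S]. *)
have [KL <- KU] := HC K CK SK.
rewrite -card_vspaceD //; apply: eq_card => x; rewrite !inE /N CK SK /=.
have -> : (x \in S) = (x \in K) && (x \in U) by rewrite -[in LHS]KU; apply: memv_cap.
case xK: (x \in K); rewrite ?andbF //=.
by rewrite (subvP KL) ?andbT.
Qed.

Lemma dimv_add_line S x : x \notin S -> \dim (S + <[x]>) = (\dim S).+1.
Proof.
move=> xS; have x0 : x != 0 by apply: contraNneq xS => ->; rewrite mem0v.
rewrite dimv_disjoint_sum ?dim_vline ?x0 ?addn1 //; apply/eqP.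
rewrite -subv0; apply/subvP => y /memv_capP[yS /vlineP[c yc]].
rewrite memv0 yc scaler_eq0 (negPf x0) orbF; apply: contraNT xS => c0.
by rewrite yc rpredZeq (negPf c0) in yS.
Qed.

(* Adjoining a vector of [L] outside [S + P] to [S] shows that the count for
   [S] is [q ^ \dim P] times the count for a space of dimension one more. *)
Lemma card_complements_above P L S (k : nat) :
    (P <= L)%VS -> (S <= L)%VS -> (S :&: P = 0)%VS -> \dim L = (k + \dim P)%N ->
  #|[pred K | [&& \dim K == k, (K <= L)%VS, (K :&: P == 0)%VS & (S <= K)%VS]]|
  = (q ^ (\dim P * (k - \dim S)))%N.
Proof.
move=> PL SL SP dL; have q_gt1 : (1 < q)%N := finNzRing_gt1 F.
have dSP : \dim (S + P) = (\dim S + \dim P)%N by apply: dimv_disjoint_sum.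
have SPL : (S + P <= L)%VS by rewrite subv_add SL.
have dS : (\dim S <= k)%N by have := dimvS SPL; rewrite dSP dL leq_add2r.
have [n dSn] : {n | k = (\dim S + n)%N} by exists (k - \dim S)%N; rewrite subnKC.
elim: n S SL SP dSP SPL dS dSn => [|n IHn] S SL SP dSP SPL dS dSn.
  rewrite dSn addn0 subnn muln0 expn0 -(card1 S); apply: eq_card => K.
  rewrite !inE; apply/idP/eqP => [/and4P[/eqP dK _ _ SK]|->].
    by apply/eqP; rewrite eq_sym eqEdim SK dK leqnn.
  by rewrite eqxx SL SP eqxx subvv.
have : (#|[pred K | [&& \dim K == k, (K <= L)%VS & (K :&: P == 0)%VS] && (S <= K)%VS]|
   * (q ^ k - q ^ \dim S) = q ^ (\dim P * n) * (q ^ \dim L - q ^ \dim (S + P)))%N.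
  apply: card_superspaces => // [|K /and3P[/eqP dK KL /eqP KP] SK|x xL xSP].
  - exact: addvSl.
  (* Since [S <= K], the sums [K + (S + P)] and [K + P] agree; comparing dimensions forces
     [K :&: (S + P)] down to [S]. *)
  - split=> //; apply/eqP; rewrite eq_sym eqEdim subv_cap SK addvSl /=.
    have := dimv_sum_cap K (S + P); rewrite dK dSP.
    have <- : (K + P = K + (S + P))%VS by rewrite addvA (addv_idPl SK).
    rewrite dimv_disjoint_sum // dK; lia.
  have xS : x \notin S by apply: contra xSP; apply/subvP/addvSl.
  have dSx := dimv_add_line xS; have dSPx := dimv_add_line xSP.
  have dSxP : \dim (S + <[x]> + P) = (\dim (S + <[x]>) + \dim P)%N.
    by rewrite -addvA (addvC <[x]>%VS) addvA dSPx dSP dSx.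
  have SxL : (S + <[x]> <= L)%VS by rewrite subv_add SL.
  have SxPL : (S + <[x]> + P <= L)%VS by rewrite subv_add SxL.
  rewrite -[in RHS](_ : (k - \dim (S + <[x]>))%N = n); last by lia.
  rewrite -IHn //; last 3 first.
  - apply/eqP; rewrite -dimv_eq0; have := dimv_sum_cap (S + <[x]>) P; lia.
  - by have := dimvS SxPL; lia.
  - by lia.
  by apply: eq_card => K; rewrite !inE -!andbA.
(* Both dimensions on the left exceed [k] and [\dim S] by [\dim P]; cancelling the common factor
   leaves one new [q ^ \dim P]. *)
have -> : (q ^ \dim L - q ^ \dim (S + P) = q ^ \dim P * (q ^ k - q ^ \dim S))%N.
  by rewrite dL dSP mulnBr -!expnD !(addnC (\dim P)).
have kS : (0 < q ^ k - q ^ \dim S)%N by rewrite subn_gt0 ltn_exp2l //; lia.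
rewrite mulnA => /eqP; rewrite eqn_pmul2r // => /eqP.
rewrite -expnD (_ : k - \dim S = n.+1)%N ?mulnS 1?addnC; last by lia.
by move=> <-; apply: eq_card => K; rewrite !inE -!andbA.
Qed.

End Counting.

(** * Lifting subspaces along a surjective linear map *)

Section Lifting.
Variables (F : finFieldType) (V W : vectType F) (p : 'Hom(V, W)).
Hypothesis p_onto : limg p = fullv.
Implicit Types (K T : {vspace V}) (J : {vspace W}) (B : {fset {vspace W}}).

Lemma lpreimK_onto J : (p @: (p @^-1: J))%VS = J.
Proof. by rewrite lpreimK // p_onto subvf. Qed.

Lemma sub_limg_preim T J : (p @: T <= J)%VS = (T <= p @^-1: J)%VS.
Proof.
apply/idP/idP => [sTJ|/(limgS p)]; last by rewrite lpreimK_onto.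
by apply/subvP=> x xT; rewrite -memv_preim (subvP sTJ) // memv_img.
Qed.

Lemma limg_preim_id K : (lker p <= K)%VS -> (p @^-1: (p @: K))%VS = K.
Proof.
move=> PK; apply/eqP; rewrite eqEsubv -sub_limg_preim subvv andbT.
apply/subvP=> x; rewrite -memv_preim => /memv_imgP[y yK pxy].
rewrite -(subrK y x) rpredD //; apply: (subvP PK).
by rewrite memv_ker linearB /= pxy subrr.
Qed.

Lemma sub_lker_preim J : (lker p <= p @^-1: J)%VS.
Proof. by rewrite -lpreim0 lpreimS ?sub0v. Qed.

Lemma dim_preim J : \dim (p @^-1: J) = (\dim J + \dim (lker p))%N.
Proof.
rewrite -(limg_ker_dim p (p @^-1: J)) lpreimK_onto addnC.
by rewrite (capv_idPr (sub_lker_preim J)).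
Qed.

(** Correspondence theorem: [J] and its preimage determine each other, and the preimages are exactly
    the subspaces containing the kernel. *)
Lemma card_above_lker B T :
  #|[pred K | [&& (lker p <= K)%VS, (p @: K)%VS \in B & (T <= K)%VS]]|
  = #|[pred J | (J \in B) && (p @: T <= J)%VS]|.
Proof.
rewrite -(card_image (can_inj lpreimK_onto)); apply: eq_card => K.
rewrite inE; apply/and3P/imageP => [[PK KB TK]|[J]].
  by exists (p @: K)%VS; rewrite ?limg_preim_id // inE KB limgS.
rewrite inE => /andP[JB TJ] ->.
by rewrite sub_lker_preim lpreimK_onto -sub_limg_preim.
Qed.

(** Sort the [K] by their image [J]. Those over a given [J] are the complements of the kernel in the
    preimage of [J] that contain [T], and their number does not depend on [J]. *)
Lemma card_off_lker B T (k : nat) : (forall J, J \in B -> \dim J = k) ->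
    (T :&: lker p = 0)%VS ->
  #|[pred K | [&& (K :&: lker p == 0)%VS, (p @: K)%VS \in B & (T <= K)%VS]]|
  = (#|[pred J | (J \in B) && (p @: T <= J)%VS]|
     * #|F| ^ (\dim (lker p) * (k - \dim T)))%N.
Proof.
move=> Bk TP; rewrite -sum_nat_const -sum1_card.
rewrite (partition_big (fun K => p @: K)%VS
  [pred J | (J \in B) && (p @: T <= J)%VS]) /=; last first.
  by move=> K /and3P[_ -> /(limgS p)].
apply: eq_bigr => J /andP[JB TJ]; rewrite sum1_card.
have dJ := Bk _ JB.
rewrite -(@card_complements_above _ _ (lker p) (p @^-1: J) T) ?sub_lker_preim //; last 2 first.
- by rewrite -sub_limg_preim.
- by rewrite dim_preim dJ.
apply: eq_card => K; rewrite unfold_in !inE -sub_limg_preim.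
have [KP|] /= := eqVneq (K :&: lker p)%VS 0%VS; last by rewrite !andbF.
rewrite -(limg_dim_eq KP) -dJ andbA.
apply/andP/andP => [[/andP[_ TK] /eqP->]|[/andP[/eqP dpK pKJ] TK]].
  by rewrite eqxx subvv.
(* A complement of the kernel keeps its dimension under [p], so its image fills [J]. *)
have /eqP pK : (p @: K == J)%VS by rewrite eqEdim pKJ dpK leqnn.
by rewrite pK JB TK eqxx.
Qed.

End Lifting.

(** * Lowering the strength of a design *)

Lemma natr_ratio (q n m k v s : nat) :
    (1 < q)%N -> (s < k)%N -> (s <= v)%N ->
    (n * (q ^ k - q ^ s) = m * (q ^ v - q ^ s))%N ->
  n%:R = m%:R * ((q%:R ^+ (v - s) - 1) / (q%:R ^+ (k - s) - 1)) :> rat.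
Proof.
move=> q1 sk sv E.
have [q0 qs0] : (0 < q)%N /\ (0 < q ^ s)%N by rewrite expn_gt0 (ltnW q1).
have nat_pred e : (s <= e)%N -> (q ^ e - q ^ s = q ^ s * (q ^ (e - s) - 1))%N.
  by move=> se; rewrite mulnBr muln1 -expnD subnKC.
have natr_pred e : (q ^ e - 1)%N%:R = q%:R ^+ e - 1 :> rat.
  by rewrite natrB ?expn_gt0 ?q0 // natrX.
have {E} : (n * (q ^ (k - s) - 1) = m * (q ^ (v - s) - 1))%N.
  apply/eqP; rewrite -(eqn_pmul2l qs0) !(mulnCA (q ^ s)%N) -!nat_pred ?E //.
  exact: ltnW.
move/(congr1 (fun a => a%:R : rat)); rewrite !natrM !natr_pred => E.
rewrite mulrA -E mulfK // subr_eq0 -natrX pnatr_eq1.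
by rewrite -[1%N](expn0 q) eqn_exp2l // subn_eq0 -ltnNge.
Qed.

(** Double counting with [S = U = T]: each vector outside [T] spans with [T] a space of dimension
    [t.+1], which lies in [lam] blocks. *)
Lemma design_strengthW (F : finFieldType) (V : vectType F) (t v k : nat)
    (lam : rat) (B : {fset {vspace V}}) : (t < k)%N -> (t <= v)%N ->
    is_subspace_design t.+1 v k lam B ->
  is_subspace_design t v k
    (lam * ((#|F|%:R ^+ (v - t) - 1) / (#|F|%:R ^+ (k - t) - 1))) B.
Proof.
move=> tk tv [dV dK Blam]; split=> // T dT.
have HC K : K \in B -> (T <= K)%VS ->
    [/\ (K <= fullv)%VS, \dim K = k & (K :&: T)%VS = T].
  by move=> KB TK; rewrite subvf (dK _ KB); split=> //; apply/capv_idPr.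
have blocks x : x \notin T ->
    #|[pred K | (K \in B) && (T + <[x]> <= K)%VS]|%:R = lam.
  by move=> xT; rewrite -card_fset_sep Blam // dimv_add_line // dT.
(* The double count needs a natural number in place of the rational [lam]. If [v = t], no vector
   lies outside [T] and [lam] may not be natural; then [m = 0] serves, as the ratio vanishes. *)
have [m Em mlam] : exists2 m, m%:R = lam \/ v = t &
    forall x, x \in fullv -> x \notin T ->
      #|[pred K | (K \in B) && (T + <[x]> <= K)%VS]| = m.
  have [fT|/subvPn[x _ xT]] := boolP (fullv <= T)%VS.
    exists 0%N; last by move=> x xf; rewrite (subvP fT).
    right; apply/eqP; rewrite eqn_leq tv -dV -dT dimvS //.
  exists #|[pred K | (K \in B) && (T + <[x]> <= K)%VS]|; first by left; apply: blocks.
  by move=> y _ yT; apply/eqP; rewrite -(eqr_nat rat) !blocks.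
have := card_superspaces (subvv T) (subvf T) HC mlam; rewrite dV dT.
move/(natr_ratio (finNzRing_gt1 F) tk tv); rewrite card_fset_sep => ->.
by case: Em => [->|->] //; rewrite subnn expr0 subrr mul0r !mulr0.
Qed.

(** * One space with both ambient spaces as its quotient *)

Lemma exists_lker0 (F : fieldType) (U W : vectType F) :
  (\dim {:U} <= \dim {:W})%N -> exists f : 'Hom(U, W), lker f == 0%VS.
Proof.
move=> dUW; pose e := vbasis {:U}; pose e' := vbasis {:W}.
have [eB e'B] : basis_of {:U} e /\ basis_of {:W} e' by split; apply: vbasisP.
exists (hommx e e' (pid_mx (\dim {:U}))).
apply/lker0P => x y; rewrite !lfunE /= => /(can_inj (vecofK e'B)).
(* The partial identity of transposed shape cancels the matrix of [f], as
   [\dim {:U} <= \dim {:W}]. *)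
move/(congr1 (mulmxr (pid_mx (\dim {:U}) : 'M_(\dim {:W}, \dim {:U})))) => /=.
rewrite -!mulmxA mul_pid_mx minnn (minn_idPr dUW) pid_mx_1 !mulmx1.
by move=> /(can_inj (rVofK eB)).
Qed.

(** The two given designs live on unrelated spaces. Take [W1 * F] with its projection to [W1], and
    follow that by an isomorphism onto [W2]; the kernel stays the same line. *)
Lemma exists_onto_dim (F : fieldType) (W1 W2 : vectType F) :
    \dim {:W1} = \dim {:W2} ->
  exists (V : vectType F) (p1 : 'Hom(V, W1)) (p2 : 'Hom(V, W2)),
    [/\ limg p1 = fullv, limg p2 = fullv, lker p1 = lker p2
      & \dim (lker p1) = 1%N].
Proof.
move=> dW; have [g g0] := exists_lker0 (eq_leq dW).
have g_onto : limg g = fullv.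
  apply/eqP; rewrite eqEdim subvf -dW limg_dim_eq ?leqnn //.
  by rewrite (eqP g0) capv0.
pose V : vectType F := (W1 * F^o)%type.
pose p : 'Hom(V, W1) := linfun fst.
have p_onto : limg p = fullv.
  apply/eqP; rewrite eqEsubv subvf; apply/subvP => w _.
  by apply/memv_imgP; exists (w, 0); rewrite ?memvf // lfunE.
exists V, p, (g \o p)%VF; split=> //; first by rewrite limg_comp p_onto.
  apply/vspaceP => x; rewrite !memv_ker comp_lfunE.
  by rewrite -[RHS]memv_ker (eqP g0) memv0.
apply/eqP; rewrite -(eqn_add2r (\dim (limg p))) -[X in _ == X]addnC.
rewrite -{1}[lker p]capfv limg_ker_dim p_onto !dimvf.
by [].
Qed.

Theorem theorem14 (q : nat) (F : finFieldType) (hF : #|F| = q)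
    (t k v : nat) (ht : (1 <= t)%N) (htk : (t <= k)%N) (hkv : (k <= v)%N)
    (lam : rat) (hlam : 0 <= lam)
    (hder : realizable F (derived_params (Params t v k lam)))
    (hres : realizable F (residual_params q (Params t v k lam))) :
  realizable F (reduced_params q (Params t v k lam)).
Proof.
case: t ht htk hder hres => // s _ sk; rewrite /reduced_params /=.
(* With [t = s.+1] the exponents become [k - s] and [v - s]; [s < a] keeps the truncated subtraction
   exact. *)
have subS a : (s < a)%N -> (a - s.+1 + 1 = a - s)%N by move=> sa; lia.
rewrite subn1 /= !subS //; last exact: leq_trans hkv.
have q_gt1 : (1 < q)%N by rewrite -hF finNzRing_gt1.
move=> [W1 [B1 D1]] [W2 [B2 D2]].
have [[/= dW1 dB1 cB1] [/= dW2 dB2 cB2]] := (D1, D2).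
have [V [p1 [p2 [p1_onto p2_onto kerE dP]]]] := exists_onto_dim (etrans dW1 (esym dW2)).
set P := lker p1 in kerE dP.
pose above K := (P <= K)%VS && ((p1 @: K)%VS \in B1).
pose off K := (K :&: P == 0)%VS && ((p2 @: K)%VS \in B2).
have [B memB] : exists B : {fset {vspace V}}, forall K, (K \in B) = above K || off K.
  by exists [fset K : {vspace V} | above K || off K]%fset => K; rewrite !inE.
exists V, B.
have dimE K : (\dim (K :&: P) + \dim (p1 @: K) = \dim K)%N by apply: limg_ker_dim.
(* As [P] is nonzero, no block is of both kinds, so counts split according to [P <= K]. *)
have above_off K : (P <= K)%VS -> (K :&: P == 0)%VS = false.
  by move=> PK; rewrite (capv_idPr PK) -dimv_eq0 dP.
split=> [|K|T dT] /=.
- by have := dimE fullv; rewrite capfv p1_onto dP dW1; lia.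
- rewrite memB => /orP[/andP[PK /dB1 d1]|/andP[/eqP KP /dB2 d2]].
    by have := dimE K; rewrite (capv_idPr PK) d1 dP; lia.
  by rewrite -d2 limg_dim_eq // -kerE.
rewrite card_fset_sep -(cardID [pred K | P <= K]%VS) natrD.
rewrite [X in X%:R + _](_ : _ =
    #|[pred J | (J \in B1) && (p1 @: T <= J)%VS]|); last first.
  rewrite -card_above_lker //; apply: eq_card => K; rewrite !inE memB /above /off -/P.
  by have [/above_off ->|] := boolP (P <= K)%VS; rewrite ?andbF /= ?orbF ?andbT.
rewrite [X in _ + X%:R](_ : _ = #|[pred K | [&& (K :&: lker p2 == 0)%VS,
    (p2 @: K)%VS \in B2 & (T <= K)%VS]]|); last first.
  apply: eq_card => K; rewrite !inE memB /above /off -kerE.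
  have [/above_off ->|] /= := boolP (P <= K)%VS; first by rewrite ?andbF.
  by rewrite andbA.
have [TP|TP] := eqVneq (T :&: P)%VS 0%VS.
  have dTi : \dim (p1 @: T) = s /\ \dim (p2 @: T) = s.
    by rewrite !limg_dim_eq -?kerE.
  rewrite (card_off_lker p2_onto dB2) -?kerE // dP mul1n dT hF natrM natrX.
  rewrite -!card_fset_sep cB1 ?cB2 ?dTi.1 ?dTi.2 //.
  (* In terms of [X = q ^ (v - k)] and [Y = q ^ (k - s)] the claim is [1 + Y * (X - 1) / (Y - 1) =
     (X * Y - 1) / (Y - 1)], scaled by [lam]. *)
  have -> : (v - s = (v - k) + (k - s))%N by lia.
  have : q%:R ^+ (k - s) != 1 :> rat.
    by rewrite -natrX pnatr_eq1 -[1%N](expn0 q) eqn_exp2l // subn_eq0 -ltnNge.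
  rewrite exprD; set Y := _ ^+ (k - s); set X := _ ^+ (v - k) => Y1.
  by field; rewrite subr_eq0.
(* A one-dimensional [P] that meets [T] nontrivially lies in [T]. *)
have PT : (P <= T)%VS.
  rewrite -dimv_eq0 in TP; apply/capv_idPr/eqP.
  by rewrite eqEdim capvSr dP lt0n.
rewrite [X in _ + X%:R]eq_card0 ?addr0; last first.
  move=> K; rewrite !inE -kerE; apply/negP => /and3P[KP _ TK].
  by rewrite above_off ?(subv_trans PT) in KP.
have dp1T : (\dim (p1 @: T)).+1 = s.
  by have := dimE T; rewrite (capv_idPr PT) dP dT.
(* The image of [T] has dimension [s - 1], so the strength of the derived design drops by one; [v],
   [k] and [s] all decrease by 1, so the exponents [v - s] and [k - s] are unchanged. *)
rewrite -dp1T /= in D1.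
have dp1Tk : (\dim (p1 @: T) < k - 1)%N by lia.
have dp1Tv : (\dim (p1 @: T) <= v - 1)%N by lia.
have [_ _ /(_ _ erefl)] := design_strengthW dp1Tk dp1Tv D1.
by rewrite card_fset_sep hF -!subnDA !add1n dp1T.
Qed.
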